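(* Let $d\in\mathbb{N}_+$. A triangulation $S$ of the cube $[0,1]^d$ has property (P) below if and only if $S$ is, up to reflections, the Kuhn triangulation; that is, if and only if $S$ is the image of the Kuhn triangulation of $[0,1]^d$ under a (possibly empty) composition of reflections $x_i\mapsto 1-x_i$, $i\in\{1,\dots,d\}$. Property (P): for every function $f:[0,1]^d\to\mathbb{R}$ and every modulus of regularity $\omega:[0,d]\to[0,\infty)$ of $f$, the continuous piecewise linear interpolant $\Phi:[0,1]^d\to\mathbb{R}$ of $f$ with respect to $S$ (the continuous function that is affine on each simplex of $S$ and satisfies $\Phi(\mathbf{y})=f(\mathbf{y})$ for all $\mathbf{y}\in\{0,1\}^d$) exists and satisfies $\|f-\Phi\|_{L^\infty([0,1]^d)}\le\omega(\frac d2)$, and $\omega$ is a modulus of regularity of $\Phi$.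
   Context: A $d$-simplex is the convex hull of $d+1$ affinely independent points of $\mathbb{R}^d$ (its vertices). A triangulation of a polytope $P\subseteq\mathbb{R}^d$ is a finite collection of $d$-simplices whose union is $P$, whose set of all vertices is exactly the vertex set of $P$ (no additional vertices), and whose interiors are pairwise disjoint. Kuhn triangulation of $[0,1]^d$: the collection of the $d!$ simplices $\operatorname{conv}\{\sum_{i=1}^k\mathbf{e}_{\tau(i)}:0\le k\le d\}$, $\tau\in S_d$, where $S_d$ is the symmetric group and $\mathbf{e}_1,\dots,\mathbf{e}_d$ are the standard basis vectors. Modulus of regularity: a function $\omega:[0,T]\to[0,\infty)$ with $\omega(0)=0$ that is monotone increasing (not necessarily strictly) and concave. It is a modulus of regularity of $g:X\to\mathbb{R}$, $X\subseteq\mathbb{R}^d$, if $|g(\mathbf{x})-g(\mathbf{y})|\le\omega(\|\mathbf{x}-\mathbf{y}\|_1)$ for all $\mathbf{x},\mathbf{y}\in X$. $\|g\|_{L^\infty(\Omega)}=\inf\{C\ge0:|g|\le C\text{ almost everywhere on }\Omega\}$. *)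

(* Defs.v *)
From HB Require Import structures.
From mathcomp Require Import all_boot all_order all_algebra all_fingroup.
From mathcomp Require Import all_classical all_reals all_analysis.

Set Implicit Arguments.
Unset Strict Implicit.
Unset Printing Implicit Defensive.

Import Order.TTheory GRing.Theory Num.Theory.
Import numFieldNormedType.Exports.

Local Open Scope classical_set_scope.
Local Open Scope ring_scope.

Definition affinely_independent (R : realType) (d n : nat)
    (v : 'I_n -> 'rV[R]_d) : Prop :=
  forall c : 'I_n -> R,
    \sum_i c i = 0 -> \sum_i c i *: v i = 0 -> forall i, c i = 0.

Definition conv_hull (R : realType) (d n : nat)
    (v : 'I_n -> 'rV[R]_d) : set 'rV[R]_d :=
  [set x | exists c : 'I_n -> R,
    [/\ forall i, 0 <= c i, \sum_i c i = 1 & x = \sum_i c i *: v i]].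

(* The vertices of a polytope are its extreme points. *)
Definition vertices (R : realType) (d : nat)
    (P : set 'rV[R]_d) : set 'rV[R]_d :=
  [set x | P x /\ forall (y z : 'rV[R]_d) (t : R),
    P y -> P z -> 0 < t < 1 -> x = t *: y + (1 - t) *: z -> y = z].

(* Simplices are not required to meet along common faces. *)
Definition triangulation (R : realType) (d : nat)
    (P : set 'rV[R]_d) (S : set (set 'rV[R]_d)) : Prop :=
  [/\ finite_set S,
      forall s, S s -> exists v : 'I_d.+1 -> 'rV[R]_d,
        affinely_independent v /\ s = conv_hull v,
      \bigcup_(s in S) s = P,
      [set x | exists v : 'I_d.+1 -> 'rV[R]_d,
        [/\ affinely_independent v, S (conv_hull v) & range v x]] = vertices P
    & trivIset S (fun s => s°)].

Definition cube (R : realType) (d : nat) : set 'rV[R]_d :=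
  [set x | forall i, 0 <= x 0 i <= 1].
Arguments cube R d : clear implicits.

Definition cube_corners (R : realType) (d : nat) : set 'rV[R]_d :=
  [set x | forall i, x 0 i = 0 \/ x 0 i = 1].
Arguments cube_corners R d : clear implicits.

Definition kuhn_point (R : realType) (d : nat) (tau : 'S_d) (k : 'I_d.+1) :
    'rV[R]_d :=
  \sum_(i < d | (i < k)%N) delta_mx 0 (tau i).

Definition kuhn (R : realType) (d : nat) : set (set 'rV[R]_d) :=
  range (fun tau : 'S_d => conv_hull (@kuhn_point R d tau)).
Arguments kuhn R d : clear implicits.

Definition reflection (R : realType) (d : nat) (i : 'I_d) (x : 'rV[R]_d) :
    'rV[R]_d :=
  \row_j (if j == i then 1 - x 0 j else x 0 j).

Definition reflections (R : realType) (d : nat) (r : seq 'I_d) :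
    'rV[R]_d -> 'rV[R]_d :=
  foldr (fun i g => @reflection R d i \o g) idfun r.

Definition norm1 (R : realType) (d : nat) (x : 'rV[R]_d) : R :=
  \sum_i `|x 0 i|.

(* Only the values of w on [0, T] matter; concavity of w is convexity of -w. *)
Definition modulus (R : realType) (T : R) (w : R -> R) : Prop :=
  [/\ forall t, t \in `[0, T] -> 0 <= w t,
      w 0 = 0,
      {in `[0, T] &, {homo w : s t / s <= t}}
    & @convex_function R R^o [set` `[0, T]] (fun t => - w t)].

Definition modulus_of (R : realType) (d : nat) (T : R) (w : R -> R)
    (X : set 'rV[R]_d) (g : 'rV[R]_d -> R) : Prop :=
  modulus T w /\
  forall x y, X x -> X y -> `|g x - g y| <= w (norm1 (x - y)).

(* Lebesgue null sets of R^d: countable covers by closed boxes of arbitrarily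
   small total volume. *)
Definition lebesgue_null (R : realType) (d : nat) (N : set 'rV[R]_d) : Prop :=
  forall e : R, 0 < e -> exists a b : nat -> 'rV[R]_d,
    [/\ forall k i, a k 0 i <= b k 0 i,
        N `<=` \bigcup_k [set x | forall i, a k 0 i <= x 0 i <= b k 0 i]
      & (\sum_(0 <= k <oo) (\prod_i (b k 0 i - a k 0 i))%:E <= e%:E)%E].

(* Valued in the extended reals: +oo when g is not essentially bounded. *)
Definition Linfty_norm (R : realType) (d : nat) (Omega : set 'rV[R]_d)
    (g : 'rV[R]_d -> R) : \bar R :=
  ereal_inf [set C%:E | C in
    [set C : R | 0 <= C /\
      lebesgue_null (Omega `&` [set x | C < `|g x|])]].

Definition affine_on (R : realType) (d : nat) (s : set 'rV[R]_d)
    (g : 'rV[R]_d -> R) : Prop :=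
  exists (l : {scalar 'rV[R]_d}) (c : R), forall x, s x -> g x = l x + c.

(* Functions on [0,1]^d are represented by functions on R^d of which only the
   restriction to the cube is constrained. *)
Definition interpolant (R : realType) (d : nat) (S : set (set 'rV[R]_d))
    (f Phi : 'rV[R]_d -> R) : Prop :=
  [/\ {within cube R d, continuous Phi},
      forall s, S s -> affine_on s Phi
    & forall y, cube_corners R d y -> Phi y = f y].

Definition optimal_interpolation (R : realType) (d : nat)
    (S : set (set 'rV[R]_d)) : Prop :=
  forall (f : 'rV[R]_d -> R) (w : R -> R),
    modulus_of d%:R w (cube R d) f ->
    exists Phi : 'rV[R]_d -> R,
      [/\ interpolant S f Phi,
          (Linfty_norm (cube R d) (fun x => f x - Phi x)%R
             <= (w (d%:R / 2))%:E)%E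
        & modulus_of d%:R w (cube R d) Phi].

(* Main.v *)
(* The Kuhn interpolant of f is its Lovasz extension: Phi x is the mean, over a
   uniform threshold t in [0, 1], of f at the corner with coordinates
   [t < x_i].  Using the same t for two points x and y, the mean 1-distance of
   these corners is |x - y|, and the mean 1-distance of x to its corner is
   \sum_i 2 x_i (1 - x_i) <= d / 2, so Jensen's inequality for the concave
   modulus gives both bounds.

   Conversely, linear moduli suffice.  If 1-Lipschitz functions have 1-Lipschitz
   interpolants, then every simplex of S has an edge in each coordinate
   direction; these edges form a spanning tree.  In a simplex containing the
   center of the cube, the center has weight 1/2 at each leaf of this tree, so it
   is the midpoint of two opposite vertices u, u' of that simplex, and u can be
   reflected to the origin.  Comparing an arbitrary point x with the points of
   the diagonal [u, u'] then shows that the vertices spanning x are ordered like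
   the coordinates of x, which is the Kuhn structure. *)

From HB Require Import structures.
From mathcomp Require Import all_boot all_order all_algebra all_fingroup.
From mathcomp Require Import all_classical all_reals all_analysis ring lra.
Require Import Defs.

Set Implicit Arguments.
Unset Strict Implicit.
Unset Printing Implicit Defensive.

Import Order.TTheory GRing.Theory Num.Theory.
Import numFieldNormedType.Exports.

Local Open Scope classical_set_scope.
Local Open Scope ring_scope.

(** * Jensen's inequality for concave moduli *)

Lemma modulus_concave (R : realType) (T : R) (w : R -> R) (p x y : R) :
  modulus T w -> 0 <= p <= 1 -> 0 <= x <= T -> 0 <= y <= T ->
  (1 - p) * w x + p * w y <= w ((1 - p) * x + p * y).
Proof.
move=> [_ _ _ cw] /andP[p0 p1] xT yT.
have := cw (Itv01 p0 p1) y x.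
rewrite !mem_setE !in_itv /= yT xT => /(_ isT isT).
rewrite !convRE /= /unstable.onem => h.
have -> : (1 - p) * x + p * y = p * y + (1 - p) * x by lra.
lra.
Qed.

(** Induction on the number of points: those after the first are replaced by their mean, with
    weights renormalized by their total [q], and concavity is applied to this mean and the first
    point. *)
Lemma modulus_jensen (R : realType) (T : R) (w : R -> R) (n : nat)
    (p a : 'I_n -> R) :
  modulus T w -> (forall m, 0 <= p m) -> \sum_m p m = 1 ->
  (forall m, 0 <= a m <= T) ->
  \sum_m p m * w (a m) <= w (\sum_m p m * a m).
Proof.
move=> mw; elim: n p a => [|n IHn] p a p0 p1 aT.
  by move: p1; rewrite big_ord0 => /eqP; rewrite eq_sym oner_eq0.
move: p1; rewrite !big_ord_recl.
set q := \sum_(i < n) p _ => pq.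
have q0 : 0 <= q by apply: sumr_ge0.
have [q_eq0|q_neq0] := eqVneq q 0.
  have p0i i : p (lift ord0 i) = 0.
    by apply/eqP; apply: contraT => h; move/eqP: q_eq0;
      rewrite psumr_eq0// => /allP/(_ i (mem_index_enum _))/= /eqP hi;
      rewrite hi eqxx in h.
  have Z (g : 'I_n -> R) : \sum_i p (lift ord0 i) * g i = 0.
    by rewrite big1// => i _; rewrite p0i mul0r.
  rewrite (Z (fun i => w (a _))) (Z (fun i => a _)).
  move: pq; rewrite q_eq0 addr0 => ->. rewrite !addr0 !mul1r. exact: lexx.
pose p' i := p (lift ord0 i) / q.
pose a' i := a (lift ord0 i).
have h1 : \sum_i p' i = 1 by rewrite -mulr_suml divff.
have h0 i : 0 <= p' i by apply: divr_ge0.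
have := IHn p' a' h0 h1 (fun i => aT _).
have E (g : 'I_n -> R) : \sum_i p (lift ord0 i) * g i = q * \sum_i p' i * g i.
  by rewrite mulr_sumr; apply: eq_bigr => i _; rewrite /p' mulrA mulrCA divff// mulr1.
rewrite (E (fun i => w (a _))) (E a') => h.
have sT : 0 <= \sum_i p' i * a' i <= T.
  apply/andP; split.
    by apply: sumr_ge0 => i _; rewrite mulr_ge0//; case/andP: (aT (lift ord0 i)).
  apply: (@le_trans _ _ (\sum_i p' i * T)); last by rewrite -mulr_suml h1 mul1r.
  by apply: ler_sum => i _; rewrite ler_wpM2l//; case/andP: (aT (lift ord0 i)).
have q1 : 0 <= q <= 1 by have := p0 ord0; lra.
have := modulus_concave mw q1 (aT ord0) sT.
have -> : 1 - q = p ord0 by lra.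
apply: le_trans; rewrite lerD2l ler_wpM2l//.
Qed.

(** * Common random thresholds *)

(** The thresholds are the left ends of the gaps of the sorted list [a :: s], weighted by the gap
    lengths; the gaps to the left of [z] have total length [z - a]. *)
Lemma path_thresholds (R : realType) (s : seq R) (a : R) : path <=%R a s ->
  exists n (p t : 'I_n -> R), [/\ forall m, 0 <= p m, forall m, a <= t m,
    \sum_m p m = last a s - a &
    forall z, z \in a :: s -> \sum_m p m * (t m < z)%R%:R = z - a].
Proof.
elim: s a => [|b s IHs] a /=.
  move=> _; exists 0%N, (fun=> 0), (fun=> 0).
  split=> [[]|[]||z]//; first by rewrite big_ord0 subrr.
  by rewrite inE => /eqP->; rewrite big_ord0 subrr.
case/andP=> ab /IHs[n [p [t [p0 bt sp pz]]]].
exists n.+1, (fun m => oapp p (b - a) (unlift ord0 m)),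
  (fun m => oapp t a (unlift ord0 m)); split=> [m|m||z].
- by case: unliftP => [j _|_] //=; lra.
- by case: unliftP => [j _|_] //=; exact: le_trans (bt _).
- rewrite big_ord_recl unlift_none /=.
  under eq_bigr do rewrite liftK /=.
  by rewrite sp; lra.
rewrite big_ord_recl unlift_none /=.
under eq_bigr do rewrite liftK /=.
rewrite inE => /predU1P[->|zs].
  rewrite ltxx mulr0 add0r subrr big1// => m _.
  by rewrite ltNge (le_trans ab (bt m)) /= mulr0.
rewrite pz//.
have bz : b <= z.
  by rewrite -subr_ge0 -pz//; apply: sumr_ge0 => m _; apply: mulr_ge0.
(* If [a < z] fails, then [a = b = z] and the first gap has length 0. *)
case: ltP => az /=; lra.
Qed.

(* Several numbers of [0, 1] are realized simultaneously as the probabilities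
   that a common random threshold lies below each of them. *)
Lemma thresholds (R : realType) (zs : seq R) :
  (forall z, z \in zs -> 0 <= z <= 1) ->
  exists n (p t : 'I_n -> R), [/\ forall m, 0 <= p m, \sum_m p m = 1 &
    forall z, z \in zs -> \sum_m p m * (t m < z)%R%:R = z].
Proof.
(* Starting the path at 0 and ending it at 1 makes the gap lengths add up to 1. *)
move=> zs01; pose s := rcons (sort <=%R zs) 1.
have ps : path <=%R 0 s.
  rewrite rcons_path path_min_sorted; last first.
    by apply/allP => z; rewrite mem_sort => /zs01/andP[].
  rewrite (sort_sorted (@le_total _ R))/=.
  have := mem_last 0 (sort <=%R zs).
  by rewrite inE => /predU1P[->//|]; rewrite mem_sort => /zs01/andP[].
have [n [p [t [p0 _ sp pz]]]] := path_thresholds ps.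
exists n, p, t; split=> [//||z zzs]; first by rewrite sp last_rcons subr0.
by rewrite pz ?subr0// inE mem_rcons inE mem_sort zzs !orbT.
Qed.

(** * The 1-norm, the cube and its reflections *)

Lemma norm1_ge0 (R : realType) (d : nat) (x : 'rV[R]_d) : 0 <= norm1 x.
Proof. exact: sumr_ge0. Qed.

Lemma norm1_eq0 (R : realType) (d : nat) (x : 'rV[R]_d) : norm1 x = 0 -> x = 0.
Proof.
move=> x0; apply/rowP => i; rewrite mxE; apply/eqP; rewrite -normr_eq0.
by apply/eqP/(psumr_eq0P _ x0).
Qed.

Lemma norm1B_triangle (R : realType) (d : nat) (x y z : 'rV[R]_d) :
  norm1 (x - z) <= norm1 (x - y) + norm1 (y - z).
Proof.
rewrite /norm1 -big_split /=; apply: ler_sum => i _; rewrite !mxE.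
have -> : x 0 i - z 0 i = (x 0 i - y 0 i) + (y 0 i - z 0 i) by ring.
exact: ler_normD.
Qed.

Lemma norm1BC (R : realType) (d : nat) (x y : 'rV[R]_d) :
  norm1 (x - y) = norm1 (y - x).
Proof. by apply: eq_bigr => i _; rewrite !mxE distrC. Qed.

Lemma norm1_cube (R : realType) (d : nat) (x y : 'rV[R]_d) :
  cube R d x -> cube R d y -> norm1 (x - y) <= d%:R.
Proof.
move=> cx cy; rewrite -[leRHS](_ : \sum_(i < d) 1 = d%:R); last first.
  by rewrite sumr_const card_ord.
apply: ler_sum => i _; rewrite !mxE ler_norml.
by move: (cx i) (cy i) => /andP[? ?] /andP[? ?]; apply/andP; split; lra.
Qed.

Lemma corner_cube (R : realType) (d : nat) (x : 'rV[R]_d) :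
  cube_corners R d x -> cube R d x.
Proof. by move=> cx i; case: (cx i) => ->; rewrite ?ler01 lexx. Qed.

Lemma comb_cube (R : realType) (d n : nat) (c : 'I_n -> R)
    (v : 'I_n -> 'rV[R]_d) :
  (forall k, 0 <= c k) -> \sum_k c k = 1 -> (forall k, cube R d (v k)) ->
  cube R d (\sum_k c k *: v k).
Proof.
move=> c0 c1 kv i; rewrite summxE; apply/andP; split.
  by apply: sumr_ge0 => k _; rewrite mxE mulr_ge0//; case/andP: (kv k i).
rewrite -c1; apply: ler_sum => k _; rewrite mxE ler_piMr//.
by case/andP: (kv k i).
Qed.

(** Every composition of reflections has this form: only the parity of the number of reflections in
    each coordinate matters, and [b] records these parities. *)
Definition flip (R : realType) (d : nat) (b : pred 'I_d) (x : 'rV[R]_d) :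
    'rV[R]_d :=
  \row_i (if b i then 1 - x 0 i else x 0 i).

Lemma flipK (R : realType) (d : nat) (b : pred 'I_d) :
  involutive (@flip R d b).
Proof.
by move=> x; apply/rowP => i; rewrite !mxE; case: (b i); rewrite ?subKr.
Qed.

Lemma flip_cube (R : realType) (d : nat) (b : pred 'I_d) (x : 'rV[R]_d) :
  cube R d x -> cube R d (flip b x).
Proof. by move=> cx i; rewrite mxE; case: ifP => _ //; case/andP: (cx i) => ? ?;
  apply/andP; split; lra. Qed.

Lemma flip_corner (R : realType) (d : nat) (b : pred 'I_d) (x : 'rV[R]_d) :
  cube_corners R d x -> cube_corners R d (flip b x).
Proof.
by move=> cx i; rewrite mxE; case: ifP => _; case: (cx i) => ->;
  rewrite ?subrr ?subr0; [right|left|left|right].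
Qed.

Lemma norm1_flip (R : realType) (d : nat) (b : pred 'I_d) (x y : 'rV[R]_d) :
  norm1 (flip b x - flip b y) = norm1 (x - y).
Proof.
apply: eq_bigr => i _; rewrite !mxE; case: ifP => _ //.
by rewrite distrC; congr `|_|; ring.
Qed.

Lemma flip_comb (R : realType) (d n : nat) (b : pred 'I_d) (c : 'I_n -> R)
    (v : 'I_n -> 'rV[R]_d) : \sum_k c k = 1 ->
  flip b (\sum_k c k *: v k) = \sum_k c k *: flip b (v k).
Proof.
move=> c1; apply/rowP => i; rewrite mxE !summxE.
under eq_bigr do rewrite !mxE.
under [RHS]eq_bigr do rewrite !mxE.
case: ifP => _ //; rewrite -[X in X - _]c1 -sumrB.
by apply: eq_bigr => k _; ring.
Qed.

Lemma flip_conv_hull (R : realType) (d n : nat) (b : pred 'I_d)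
    (v : 'I_n -> 'rV[R]_d) :
  flip b @` conv_hull v = conv_hull (fun k => flip b (v k)).
Proof.
apply/seteqP; split=> [_ [_ [c [c0 c1 ->]] <-]|_ [c [c0 c1 ->]]].
  by exists c; rewrite flip_comb.
by exists (\sum_k c k *: v k); rewrite ?flip_comb//; exists c.
Qed.

Lemma reflectionsE (R : realType) (d : nat) (r : seq 'I_d) :
  @reflections R d r = flip (fun i => odd (count_mem i r)).
Proof.
apply/funext => x; apply/rowP => i.
elim: r => [|j r IHr]; first by rewrite !mxE.
rewrite [LHS]mxE -/(reflections r x) IHr !mxE /= oddD eq_sym.
by case: eqP => _; case: (odd (count _ _)) => //=; rewrite ?subKr.
Qed.

(** * Kuhn simplices and sorted coordinates *)

Definition flipped_kuhn (R : realType) (d : nat) (b : pred 'I_d) :=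
  range (fun tau : 'S_d => conv_hull (fun k => flip b (kuhn_point R tau k))).
Arguments flipped_kuhn R {d} b.

Lemma reflected_kuhnE (R : realType) (d : nat) (r : seq 'I_d) :
  [set reflections r @` s | s in kuhn R d]
  = flipped_kuhn R (fun i => odd (count_mem i r)).
Proof.
rewrite /kuhn image_comp reflectionsE.
by apply: eq_imagel => tau _ /=; rewrite flip_conv_hull.
Qed.

Lemma kuhn_pointE (R : realType) (d : nat) (tau : 'S_d) (k : 'I_d.+1) (i : 'I_d) :
  kuhn_point R tau k 0 (tau i) = (i < k)%:R.
Proof.
rewrite summxE; under eq_bigr do rewrite mxE eqxx (inj_eq perm_inj) /=.
case: ltnP => ik.
  rewrite (bigD1 i)//= eqxx big1 ?addr0// => j /andP[_ /negbTE].
  by rewrite eq_sym => ->.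
rewrite big1// => j jk; case: eqP => // ij.
by rewrite -ij ltnNge ik in jk.
Qed.

Lemma kuhn_point_corner (R : realType) (d : nat) (tau : 'S_d) (k : 'I_d.+1) :
  cube_corners R d (kuhn_point R tau k).
Proof.
by move=> i; rewrite -(permKV tau i) kuhn_pointE; case: ltnP; [right|left].
Qed.

Lemma kuhn_point_inj (R : realType) (d : nat) (tau : 'S_d) :
  injective (@kuhn_point R d tau).
Proof.
have le_k (k l : 'I_d.+1) :
    kuhn_point R tau k = kuhn_point R tau l -> (k <= l)%N.
  move=> /rowP kl; rewrite leqNgt; apply/negP => lk.
  have ld : (l < d)%N by rewrite (leq_trans lk)// -ltnS.
  have := kl (tau (Ordinal ld)).
  by rewrite !kuhn_pointE /= lk ltnn => /eqP; rewrite oner_eq0.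
by move=> k l kl; apply/val_inj/anti_leq; rewrite !le_k.
Qed.

Lemma ord_down_set (d : nat) (P : pred nat) :
  (forall k, P k.+1 -> P k) ->
  exists2 m, (m <= d)%N & forall k, (k < d)%N -> P k = (k < m)%N.
Proof.
move=> Pd; elim: d => [|d [m md IHd]]; first by exists 0%N.
have [Pdt|Pdf] := boolP (P d); last first.
  exists m => [|k]; first exact: ltnW.
  rewrite ltnS leq_eqVlt => /predU1P[->|]; last exact: IHd.
  by rewrite (negbTE Pdf) ltnNge md.
exists d.+1 => // k; rewrite ltnS => kd; rewrite kd.
move: Pdt; rewrite -(subnKC kd).
by elim: (d - k)%N => [|e IHe]; rewrite ?addn0// addnS => /Pd.
Qed.

(** Within the cube, these inequalities cut out the Kuhn simplex of [tau]. *)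
Definition sorted_by (R : realType) (d : nat) (x : 'rV[R]_d) (tau : 'S_d) :=
  forall i j : 'I_d, (i <= j)%N -> x 0 (tau j) <= x 0 (tau i).

Lemma sorted_by_exists (R : realType) (d : nat) (x : 'rV[R]_d) :
  exists tau, sorted_by x tau.
Proof.
case: d x => [|d] x; first by exists 1%g => -[].
pose r := fun i j : 'I_d.+1 => x 0 j <= x 0 i.
pose s := sort r (enum 'I_d.+1).
have ss : size s = d.+1 by rewrite size_sort size_enum_ord.
have us : uniq s by rewrite sort_uniq enum_uniq.
have inj : injective (fun i : 'I_d.+1 => nth ord0 s i).
  by move=> i j /eqP; rewrite nth_uniq ?ss// => /eqP/val_inj.
exists (perm inj) => i j ij; rewrite !permE.
have rt : transitive r by move=> a b c ab bc; exact: le_trans bc ab.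
have rr : reflexive r by move=> a; exact: lexx.
apply: (sorted_leq_nth rt rr ord0 _ _ _ _ _ ij); rewrite ?inE ?ss//.
by apply: sort_sorted => a b; exact: le_total.
Qed.

(** Read along [tau], the coordinates are ones followed by zeros, and [m] is the number of ones. *)
Lemma sorted_corner (R : realType) (d : nat) (x : 'rV[R]_d) (tau : 'S_d) :
  cube_corners R d x -> sorted_by x tau -> exists m, x = kuhn_point R tau m.
Proof.
move=> cx sx; pose P k := if insub k is Some i then x 0 (tau i) == 1 else false.
have [|m md Pm] := @ord_down_set d P.
  move=> k; rewrite /P; case: insubP => // i _ /= ki /eqP xi.
  have kd : (k < d)%N by move: (ltn_ord i); rewrite ki => /ltnW.
  rewrite insubT /=; case: (cx (tau (Ordinal kd))) => [x0|->]; last exact: eqxx.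
  by have := sx (Ordinal kd) i; rewrite x0 xi ler10 /= ki leqnSn => /(_ isT).
have md1 : (m < d.+1)%N by [].
exists (Ordinal md1); apply/rowP => i; rewrite -(permKV tau i) kuhn_pointE /=.
rewrite -Pm// /P valK.
by case: (cx (tau ((tau^-1)%g i))) => ->; rewrite ?eqxx// eq_sym oner_eq0.
Qed.

Lemma conv_kuhn_sorted (R : realType) (d : nat) (tau : 'S_d)
    (x : 'rV[R]_d) : conv_hull (kuhn_point R tau) x -> sorted_by x tau.
Proof.
move=> [c [c0 _ ->]] i j ij; rewrite !summxE; apply: ler_sum => k _.
rewrite !mxE !kuhn_pointE ler_wpM2l// ler_nat.
by case: (ltnP j k) => // jk; rewrite (leq_ltn_trans ij jk).
Qed.

(** * The Lovasz extension *)

Definition level (R : realType) (d : nat) (t : R) (x : 'rV[R]_d) : 'rV[R]_d :=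
  \row_i ((t < x 0 i)%R%:R).

Lemma level_corner (R : realType) (d : nat) (t : R) (x : 'rV[R]_d) :
  cube_corners R d (level t x).
Proof. by move=> i; rewrite mxE; case: ltP; [right|left]. Qed.

Lemma level_sorted (R : realType) (d : nat) (t : R) (x : 'rV[R]_d) (tau : 'S_d) :
  sorted_by x tau -> sorted_by (level t x) tau.
Proof.
move=> sx i j ij; rewrite !mxE ler_nat; case: (ltP t (x 0 (tau j))) => // tj.
by rewrite (lt_le_trans tj) ?sx.
Qed.

(** Indexed by [nat] so that sums of increments telescope; [inord] gives the intended vertex for
    [k <= d]. *)
Definition kuhn_value (R : realType) (d : nat) (h : 'rV[R]_d -> R)
    (tau : 'S_d) (k : nat) : R :=
  h (kuhn_point R tau (inord k)).

(** The affine interpolant of [h] on the Kuhn simplex of [tau]: consecutive vertices differ by a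
    unit vector, so the increments of [h] are the slopes. *)
Definition kuhn_affine (R : realType) (d : nat) (h : 'rV[R]_d -> R)
    (tau : 'S_d) (x : 'rV[R]_d) : R :=
  kuhn_value h tau 0 + \sum_(k < d)
    x 0 (tau k) * (kuhn_value h tau k.+1 - kuhn_value h tau k).

Lemma kuhn_affine_point (R : realType) (d : nat) (h : 'rV[R]_d -> R)
    (tau : 'S_d) (m : 'I_d.+1) :
  kuhn_affine h tau (kuhn_point R tau m) = h (kuhn_point R tau m).
Proof.
rewrite /kuhn_affine; set H := kuhn_value h tau.
have -> : h (kuhn_point R tau m) = H m by rewrite /H /kuhn_value inord_val.
have -> : \sum_(k < d) kuhn_point R tau m 0 (tau k) * (H k.+1 - H k) = H m - H 0%N.
  under eq_bigr do rewrite kuhn_pointE mulr_natl mulrb.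
  rewrite -big_mkcond /= -(big_ord_widen_cond d xpredT (fun k => H k.+1 - H k))//.
    by rewrite -(big_mkord xpredT (fun k => H k.+1 - H k)) telescope_sumr.
  by rewrite -ltnS.
by rewrite addrC subrK.
Qed.

Lemma kuhn_affine_comb (R : realType) (d n : nat) (h : 'rV[R]_d -> R)
    (tau : 'S_d) (c : 'I_n -> R) (x : 'I_n -> 'rV[R]_d) :
  \sum_m c m = 1 ->
  kuhn_affine h tau (\sum_m c m *: x m) = \sum_m c m * kuhn_affine h tau (x m).
Proof.
move=> c1; rewrite /kuhn_affine.
under [RHS]eq_bigr do rewrite mulrDr.
rewrite big_split /= -mulr_suml c1 mul1r; congr (_ + _).
under [RHS]eq_bigr do rewrite mulr_sumr.
rewrite exchange_big; apply: eq_bigr => k _.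
rewrite summxE mulr_suml; apply: eq_bigr => m _.
by rewrite !mxE mulrA.
Qed.

Definition thresholds_for (R : realType) (d n : nat) (p t : 'I_n -> R)
    (x : 'rV[R]_d) :=
  forall i, \sum_m p m * (t m < x 0 i)%R%:R = x 0 i.

Lemma thresholds_comb (R : realType) (d n : nat) (p t : 'I_n -> R)
    (x : 'rV[R]_d) : thresholds_for p t x -> \sum_m p m *: level (t m) x = x.
Proof.
move=> px; apply/rowP => i; rewrite summxE -[RHS]px.
by apply: eq_bigr => m _; rewrite !mxE.
Qed.

Lemma thresholds_pair (R : realType) (d : nat) (x y : 'rV[R]_d) :
  cube R d x -> cube R d y ->
  exists n (p t : 'I_n -> R), [/\ forall m, 0 <= p m, \sum_m p m = 1,
    thresholds_for p t x & thresholds_for p t y].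
Proof.
move=> cx cy.
pose zs := [seq x 0 i | i <- enum 'I_d] ++ [seq y 0 i | i <- enum 'I_d].
have [|n [p [t [p0 p1 pz]]]] := @thresholds R zs.
  by move=> z; rewrite mem_cat => /orP[] /mapP[i _ ->].
exists n, p, t; split=> // i; apply: pz; rewrite mem_cat.
  by rewrite (map_f (fun i => x 0 i)) ?mem_enum.
by rewrite (map_f (fun i => y 0 i)) ?mem_enum ?orbT.
Qed.

(** The level corners of [x] are vertices of the simplex of [tau], where the affine formula
    reproduces [h]. The right side is free of [tau], which makes [lovasz] independent of the chosen
    sorting permutation on the cube. *)
Lemma kuhn_affine_thresholds (R : realType) (d n : nat) (h : 'rV[R]_d -> R)
    (tau : 'S_d) (p t : 'I_n -> R) (x : 'rV[R]_d) :
  \sum_m p m = 1 -> thresholds_for p t x -> sorted_by x tau ->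
  kuhn_affine h tau x = \sum_m p m * h (level (t m) x).
Proof.
move=> p1 px sx; rewrite -[in LHS](thresholds_comb px) kuhn_affine_comb//.
apply: eq_bigr => m _; congr (_ * _).
have [k ->] := sorted_corner (@level_corner _ _ (t m) x) (level_sorted (t m) sx).
exact: kuhn_affine_point.
Qed.

Definition lovasz (R : realType) (d : nat) (h : 'rV[R]_d -> R) (x : 'rV[R]_d) : R :=
  kuhn_affine h (projT1 (cid (sorted_by_exists x))) x.

Lemma lovasz_thresholds (R : realType) (d n : nat) (h : 'rV[R]_d -> R)
    (p t : 'I_n -> R) (x : 'rV[R]_d) :
  \sum_m p m = 1 -> thresholds_for p t x ->
  lovasz h x = \sum_m p m * h (level (t m) x).
Proof.
by move=> p1 px; apply: kuhn_affine_thresholds => //; case: cid.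
Qed.

Lemma lovasz_sorted (R : realType) (d : nat) (h : 'rV[R]_d -> R)
    (tau : 'S_d) (x : 'rV[R]_d) :
  cube R d x -> sorted_by x tau -> lovasz h x = kuhn_affine h tau x.
Proof.
move=> cx sx; have [n [p [t [p0 p1 px _]]]] := thresholds_pair cx cx.
by rewrite (lovasz_thresholds h p1 px) (kuhn_affine_thresholds h p1 px sx).
Qed.

Lemma lovasz_corner (R : realType) (d : nat) (h : 'rV[R]_d -> R) (x : 'rV[R]_d) :
  cube_corners R d x -> lovasz h x = h x.
Proof.
move=> cx; have [tau sx] := sorted_by_exists x.
rewrite (lovasz_sorted h (corner_cube cx) sx).
by have [k ->] := sorted_corner cx sx; exact: kuhn_affine_point.
Qed.

(** Only the corner values of [h] are assumed to be controlled by [w]; this allows a linear [w] in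
    the proof of continuity. *)
Lemma lovasz_modulus (R : realType) (d : nat) (w : R -> R) (h : 'rV[R]_d -> R)
    (x y : 'rV[R]_d) :
  modulus d%:R w ->
  (forall a b, cube_corners R d a -> cube_corners R d b ->
    `|h a - h b| <= w (norm1 (a - b))) ->
  cube R d x -> cube R d y -> `|lovasz h x - lovasz h y| <= w (norm1 (x - y)).
Proof.
move=> mw hw cx cy; have [n [p [t [p0 p1 px py]]]] := thresholds_pair cx cy.
rewrite (lovasz_thresholds h p1 px) (lovasz_thresholds h p1 py) -sumrB.
pose a m := norm1 (level (t m) x - level (t m) y).
(* With a common threshold the two indicators in a coordinate are nested, so their mean distance is
   the distance of the coordinates. *)
have -> : norm1 (x - y) = \sum_m p m * a m.
  under [RHS]eq_bigr do rewrite mulr_sumr.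
  rewrite exchange_big; apply: eq_bigr => i _; rewrite !mxE.
  wlog xy : x y cx cy px py {a} / x 0 i <= y 0 i.
    move=> W; case: (leP (x 0 i) (y 0 i)) => [/W->//|/ltW/W].
    rewrite distrC => ->//; apply: eq_bigr => m _.
    by rewrite !mxE distrC.
  rewrite ler0_norm ?subr_le0// -[in LHS]px -[in LHS]py -sumrB -sumrN.
  apply: eq_bigr => m _; rewrite !mxE -mulrBr -mulrN opprB; congr (_ * _).
  case: (ltP (t m) (x 0 i)) => [tx|_]; last by rewrite sub0r normrN subr0 ger0_norm.
  by rewrite (lt_le_trans tx xy) subrr normr0.
apply: le_trans (modulus_jensen mw p0 p1 _); last first.
  by move=> m; rewrite norm1_ge0 norm1_cube//; apply/corner_cube/level_corner.
apply: le_trans (ler_norm_sum _ _ _) _; apply: ler_sum => m _.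
rewrite -mulrBr normrM ger0_norm// ler_wpM2l// hw//; exact: level_corner.
Qed.

Lemma lovasz_error (R : realType) (d : nat) (w : R -> R)
    (f : 'rV[R]_d -> R) (x : 'rV[R]_d) :
  modulus_of d%:R w (cube R d) f ->
  cube R d x -> `|f x - lovasz f x| <= w (d%:R / 2).
Proof.
move=> [mw fw] cx; have [n [p [t [p0 p1 px _]]]] := thresholds_pair cx cx.
rewrite (lovasz_thresholds f p1 px) -[f x](_ : \sum_m p m * f x = f x); last first.
  by rewrite -mulr_suml p1 mul1r.
rewrite -sumrB.
pose a m := norm1 (x - level (t m) x).
have a0 m : 0 <= a m <= d%:R.
  by rewrite norm1_ge0 norm1_cube//; apply/corner_cube/level_corner.
have aE : \sum_m p m * a m = \sum_i 2 * (x 0 i * (1 - x 0 i)).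
  under eq_bigr do rewrite mulr_sumr.
  rewrite exchange_big; apply: eq_bigr => i _; have /andP[x0 x1] := cx i.
  under eq_bigr => m _.
    rewrite !mxE (_ : `|_| = x 0 i + (t m < x 0 i)%R%:R * (1 - 2 * x 0 i)).
      rewrite mulrDr mulrA; over.
    by case: (ltP (t m)) => _ /=; [rewrite ler0_norm|rewrite ger0_norm]; lra.
  by rewrite big_split /= -!mulr_suml p1 px; ring.
have aT : 0 <= \sum_m p m * a m <= d%:R / 2.
  rewrite sumr_ge0 => [|m _]; last by rewrite mulr_ge0//; case/andP: (a0 m).
  have -> : d%:R / 2 = \sum_(i < d) 2^-1 :> R by rewrite sumr_const card_ord mulr_natl.
  rewrite aE /=.
  (* In each coordinate, [2 x (1 - x) <= 1/2] amounts to [0 <= (1 - 2 x)^2]. *)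
  by apply: ler_sum => i _; have := sqr_ge0 (1 - 2 * x 0 i); rewrite expr2; lra.
have d0 : 0 <= d%:R :> R by [].
apply: (@le_trans _ _ (w (\sum_m p m * a m))); last first.
  case: mw => _ _ mono _; case/andP: aT => aT0 aT1.
  by apply: (mono _ _ _ _ aT1); rewrite in_itv /=; apply/andP; split; lra.
apply: le_trans (modulus_jensen mw p0 p1 a0).
apply: le_trans (ler_norm_sum _ _ _) _; apply: ler_sum => m _.
rewrite -mulrBr normrM ger0_norm// ler_wpM2l// fw//.
exact/corner_cube/level_corner.
Qed.

(** * Optimality of the reflected Kuhn triangulations *)

Lemma norm1_lipschitz_continuous (R : realType) (d : nat) (C : R)
    (A : set 'rV[R]_d) (g : 'rV[R]_d -> R) : 0 <= C ->
  (forall x y, A x -> A y -> `|g x - g y| <= C * norm1 (x - y)) ->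
  {within A, continuous g}.
Proof.
move=> C0 gC; apply/subspace_continuousP => x Ax.
apply/cvgrPdist_le => e e0; rewrite near_withinE.
have k0 : 0 < C * d%:R + 1 by rewrite ltr_wpDl// mulr_ge0.
near=> y => Ay; apply: le_trans (gC _ _ Ax Ay) _.
have xy : ball x (e / (C * d%:R + 1)) y.
  by near: y; apply: nbhsx_ballx; exact: divr_gt0.
have n1 : norm1 (x - y) <= d%:R * (e / (C * d%:R + 1)).
  rewrite -[d in d%:R * _]card_ord mulr_natl -sumr_const.
  apply: ler_sum => i _; rewrite !mxE; apply: ltW.
  by have [_ /(_ 0 i)] := xy; rewrite -ball_normE.
apply: le_trans (ler_wpM2l C0 n1) _.
by rewrite !mulrA ler_pdivrMr// mulrC ler_wpM2l ?(ltW e0)// lerDl.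
Unshelve. all: by end_near. Qed.

Definition row_form (R : realType) (d : nat) (a : 'I_d -> R) (x : 'rV[R]_d) : R :=
  \sum_i x 0 i * a i.

Lemma row_form_is_linear (R : realType) (d : nat) (a : 'I_d -> R) :
  scalar (@row_form R d a).
Proof.
move=> k x y; rewrite /row_form mulr_sumr -big_split /=.
by apply: eq_bigr => i _; rewrite !mxE; ring.
Qed.

HB.instance Definition _ (R : realType) (d : nat) (a : 'I_d -> R) :=
  GRing.isLinear.Build R 'rV[R]_d R _ (@row_form R d a) (row_form_is_linear a).

Lemma affine_on_flipped_kuhn (R : realType) (d : nat) (b : pred 'I_d)
    (h : 'rV[R]_d -> R) (tau : 'S_d) :
  affine_on (conv_hull (fun k => flip b (kuhn_point R tau k)))
    (fun x => lovasz h (flip b x)).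
Proof.
pose D k := kuhn_value h tau k.+1 - kuhn_value h tau k.
(* A reflected coordinate reverses the sign of its slope; [tau^-1] gives the position of coordinate
   [i] in the order. *)
pose a i := (if b i then -1 else 1) * D (tau^-1 i)%g.
exists (row_form a), (kuhn_affine h tau (flip b 0)) => x.
rewrite -flip_conv_hull => -[y Ky <-{x}]; rewrite flipK.
have cy : cube R d y.
  case: Ky => c [c0 c1 ->]; apply: comb_cube => // k.
  exact/corner_cube/kuhn_point_corner.
rewrite (lovasz_sorted h cy (conv_kuhn_sorted Ky)).
rewrite /kuhn_affine /= /row_form addrCA; congr (_ + _).
rewrite [X in X + _](reindex_inj (@perm_inj _ tau)) -big_split /=.
apply: eq_bigr => k _; rewrite /a permK !mxE /D.
by case: (b _); ring.
Qed.

Lemma Linfty_norm_le (R : realType) (d : nat) (g : 'rV[R]_d -> R) (C : R) :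
  (0 < d)%N -> 0 <= C -> (forall x, cube R d x -> `|g x| <= C) ->
  (Linfty_norm (cube R d) g <= C%:E)%E.
Proof.
move=> d0 C0 gC; apply: ereal_inf_lbound; exists C => //; split=> //.
move=> e e0; exists (fun=> 0), (fun=> 0); split=> //.
  by move=> x [/gC + /= Cx]; rewrite leNgt Cx.
(* The degenerate boxes are null because [0 < d]; an empty product would be 1. *)
have -> : \prod_(i < d) ((0 : 'rV[R]_d) 0 i - (0 : 'rV[R]_d) 0 i) = 0.
  by rewrite (bigD1 (Ordinal d0))//= subrr mul0r.
by rewrite eseries0// lee_fin ltW.
Qed.

Lemma optimal_flipped_kuhn (R : realType) (d : nat) (b : pred 'I_d) :
  (0 < d)%N -> optimal_interpolation (flipped_kuhn R b).
Proof.
move=> d0 f w [mw fw].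
have mw' := mw; case: mw' => w0 w00 mono _.
pose h x := f (flip b x).
have hw x y : cube R d x -> cube R d y -> `|h x - h y| <= w (norm1 (x - y)).
  by move=> cx cy; rewrite -(norm1_flip b) fw//; exact: flip_cube.
have Ew x y : cube R d x -> cube R d y ->
    `|lovasz h (flip b x) - lovasz h (flip b y)| <= w (norm1 (x - y)).
  move=> cx cy; rewrite -(norm1_flip b).
  apply: lovasz_modulus; [exact: mw| |exact: flip_cube..].
  by move=> u v cu cv; apply: hw; exact: corner_cube.
have d00 : 0 <= d%:R :> R by [].
exists (fun x => lovasz h (flip b x)); split=> //.
- split.
  (* [w] may jump at 0, so continuity is derived from the linear modulus with slope [w d%:R]. *)
  + have wd : 0 <= w d%:R by apply: w0; rewrite in_itv /= lexx d00.
    apply: (norm1_lipschitz_continuous wd) => x y cx cy.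
    rewrite -(norm1_flip b).
    apply: (@lovasz_modulus _ _ (fun t => w d%:R * t)); [| |exact: flip_cube..].
      split=> [t|||].
      * by rewrite in_itv /= => /andP[t0 _]; rewrite mulr_ge0.
      * by rewrite mulr0.
      * by move=> s t _ _ st; rewrite ler_wpM2l.
      * move=> p x0 y0 _ _; rewrite convRE /= /unstable.onem.
        have -> : conv p x0 y0 = p%:num * x0 + (1 - p%:num) * y0 :> R by [].
        by rewrite le_eqVlt; apply/orP; left; apply/eqP; ring.
    move=> u v cu cv; apply: (le_trans (hw _ _ (corner_cube cu) (corner_cube cv))).
    have nd : norm1 (u - v) <= d%:R by apply: norm1_cube; exact: corner_cube.
    have n0 := norm1_ge0 (u - v).
    have [->|uv] := eqVneq u v.
      by rewrite subrr /norm1 big1 ?w00 ?mulr0// => i _; rewrite mxE normr0.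
    (* Distinct corners are at distance at least 1, so the constant bound [w d%:R] implies the
       linear one. *)
    have n1 : 1 <= norm1 (u - v).
      have [i ui] : exists i, u 0 i != v 0 i.
        apply/existsP; apply: contraNT uv => /existsPn h'.
        by apply/eqP/rowP => i; apply/eqP; move: (h' i); rewrite negbK.
      rewrite /norm1 (bigD1 i)//= (_ : `|_| = 1) ?lerDl ?sumr_ge0//.
      move: ui; rewrite !mxE; case: (cu i) (cv i) => -> [] ->;
        by rewrite ?eqxx// ?subr0 ?sub0r ?normrN normr1.
    apply: (@le_trans _ _ (w d%:R)); last by rewrite ler_peMr.
    by apply: (mono _ _ _ _ nd); rewrite in_itv /= ?n0 ?nd ?d00 ?lexx.
  + by move=> _ [tau _ <-]; exact: affine_on_flipped_kuhn.
  + by move=> y cy; rewrite lovasz_corner ?/h ?flipK//; exact: flip_corner.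
- have d2 : d%:R / 2 \in `[0, d%:R : R] by rewrite in_itv /=; lra.
  apply: Linfty_norm_le => //; first exact: w0.
  move=> x cx; rewrite -[in f x](flipK b x) -/(h _).
  by apply: (@lovasz_error _ _ w) (flip_cube _ _) => //; split.
Qed.

(** * From optimality to a Lipschitz condition *)

(** A point with [0 < x_i < 1] lies strictly between the points obtained by setting its [i]-th
    coordinate to 0 and to 1. *)
Lemma vertices_cube (R : realType) (d : nat) (x : 'rV[R]_d) :
  vertices (cube R d) x -> cube_corners R d x.
Proof.
move=> [cx ext] i; have /andP[x0 x1] := cx i.
have [->|xi0] := eqVneq (x 0 i) 0; first by left.
have [->|xi1] := eqVneq (x 0 i) 1; first by right.
pose set_i (a : R) : 'rV[R]_d := \row_j (if j == i then a else x 0 j).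
have c a : 0 <= a <= 1 -> cube R d (set_i a).
  by move=> a01 j; rewrite mxE; case: eqP.
have /rowP/(_ i) : set_i 1 = set_i 0.
  apply: (ext _ _ (x 0 i)); [by apply: c; rewrite ler01 lexx..| |].
    by rewrite !lt_neqAle x0 x1 xi1 eq_sym xi0.
  by apply/rowP => j; rewrite !mxE; case: eqP => [->|_]; ring.
by rewrite !mxE eqxx => /eqP; rewrite oner_eq0.
Qed.

Lemma triangulation_simplex (R : realType) (d : nat) (S : set (set 'rV[R]_d))
    (s : set 'rV[R]_d) :
  triangulation (cube R d) S -> S s -> exists v : 'I_d.+1 -> 'rV[R]_d,
    [/\ affinely_independent v, s = conv_hull v & forall k, cube_corners R d (v k)].
Proof.
move=> [_ simp _ vert _] Ss; have [v [av sE]] := simp _ Ss.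
exists v; split=> // k; apply: vertices_cube; rewrite -vert.
by exists v; split; rewrite -?sE//; exists k.
Qed.

Definition lipschitz1 (R : realType) (d : nat) (f : 'rV[R]_d -> R) :=
  forall x y, f x <= f y + norm1 (x - y).

(** What optimality yields for the modulus [id], with the interpolant eliminated: its values are
    written through barycentric weights and vertex values of [f]. *)
Definition lipschitz_interpolation (R : realType) (d : nat)
    (S : set (set 'rV[R]_d)) :=
  forall (f : 'rV[R]_d -> R) (v v' : 'I_d.+1 -> 'rV[R]_d) (c c' : 'I_d.+1 -> R),
    lipschitz1 f -> S (conv_hull v) -> S (conv_hull v') ->
    (forall k, cube_corners R d (v k)) -> (forall k, cube_corners R d (v' k)) ->
    (forall k, 0 <= c k) -> (forall k, 0 <= c' k) ->
    \sum_k c k = 1 -> \sum_k c' k = 1 ->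
    \sum_k c k * f (v k) <=
      \sum_k c' k * f (v' k) + norm1 (\sum_k c k *: v k - \sum_k c' k *: v' k).

Lemma conv_hull_vertex (R : realType) (d n : nat) (v : 'I_n -> 'rV[R]_d) k :
  conv_hull v (v k).
Proof.
exists (fun l => (l == k)%:R); split => [//||].
  by rewrite (bigD1 k)//= eqxx big1 ?addr0// => l /negbTE->.
by rewrite (bigD1 k)//= eqxx scale1r big1 ?addr0// => l /negbTE->; rewrite scale0r.
Qed.

Lemma affine_on_comb (R : realType) (d n : nat) (v : 'I_n -> 'rV[R]_d)
    (c : 'I_n -> R) (g : 'rV[R]_d -> R) :
  affine_on (conv_hull v) g -> (forall k, 0 <= c k) -> \sum_k c k = 1 ->
  g (\sum_k c k *: v k) = \sum_k c k * g (v k).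
Proof.
move=> [l [a gE]] c0 c1; rewrite gE; last by exists c.
rewrite linear_sum -[a]mul1r -[X in X * a]c1 mulr_suml -big_split /=.
apply: eq_bigr => k _; rewrite gE ?linearZ ?mulrDr//; exact: conv_hull_vertex.
Qed.

Lemma optimal_lipschitz (R : realType) (d : nat) (S : set (set 'rV[R]_d)) :
  \bigcup_(s in S) s = cube R d -> optimal_interpolation S ->
  lipschitz_interpolation S.
Proof.
move=> cS oS f v v' c c' lf Sv Sv' kv kv' c0 c'0 c1 c'1.
have mid : modulus d%:R (@id R).
  split=> //; first by move=> t; rewrite in_itv => /andP[].
  move=> p x y _ _; rewrite convRE /= /unstable.onem.
  have -> : conv p x y = p%:num * x + (1 - p%:num) * y :> R by [].
  by rewrite le_eqVlt; apply/orP; left; apply/eqP; ring.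
have [|Phi [[_ aPhi PhiE] _ [_ mPhi]]] := oS f id.
  split=> // x y _ _; rewrite ler_norml; apply/andP; split.
    by have := lf y x; rewrite norm1BC; lra.
  by have := lf x y; lra.
have E (u : 'I_d.+1 -> 'rV[R]_d) a : S (conv_hull u) ->
    (forall k, cube_corners R d (u k)) -> (forall k, 0 <= a k) ->
    \sum_k a k = 1 -> \sum_k a k * f (u k) = Phi (\sum_k a k *: u k).
  move=> Su ku a0 a1; rewrite (affine_on_comb (aPhi _ Su))//.
  by apply: eq_bigr => k _; rewrite PhiE.
rewrite (E v)// (E v')// -lerBlDl; apply: le_trans (ler_norm _) _.
by apply: mPhi; rewrite -cS; [exists (conv_hull v)|exists (conv_hull v')] => //;
  [exists c|exists c'].
Qed.

(** * Edges in every coordinate direction *)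

(** A supply of 1-Lipschitz test functions that, for [a >= 0], vanish at selected points; the cap
    [a] is also the value if no point is selected. *)
Definition capped_dist (R : realType) (d n : nat) (a : R) (P : pred 'I_n)
    (v : 'I_n -> 'rV[R]_d) (x : 'rV[R]_d) : R :=
  \big[Num.min/a]_(k | P k) norm1 (x - v k).

Lemma capped_dist_lipschitz (R : realType) (d n : nat) (a : R) (P : pred 'I_n)
    (v : 'I_n -> 'rV[R]_d) : lipschitz1 (capped_dist a P v).
Proof.
move=> x y; rewrite -lerBlDr; apply/bigmin_geP; split.
  rewrite lerBlDr (le_trans (bigmin_le_id _ _ _ _))// lerDl; exact: norm1_ge0.
move=> k Pk; rewrite lerBlDr (le_trans (bigmin_le_cond _ _ Pk))// [leRHS]addrC.
exact: norm1B_triangle.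
Qed.

Lemma capped_dist_eq0 (R : realType) (d n : nat) (a : R) (P : pred 'I_n)
    (v : 'I_n -> 'rV[R]_d) k : 0 <= a -> P k -> capped_dist a P v (v k) = 0.
Proof.
move=> a0 Pk; apply/le_anti/andP; split.
  rewrite (le_trans (bigmin_le_cond _ _ Pk))// subrr.
  by rewrite /norm1 big1// => i _; rewrite mxE normr0.
by apply/bigmin_geP; split=> // l _; exact: norm1_ge0.
Qed.

Lemma norm1_delta (R : realType) (d : nat) (i : 'I_d) :
  norm1 (delta_mx 0 i : 'rV[R]_d) = 1.
Proof.
rewrite /norm1 (bigD1 i)//= mxE !eqxx normr1 big1 ?addr0// => j ji.
by rewrite mxE eqxx (negbTE ji) normr0.
Qed.

Lemma norm1Z (R : realType) (d : nat) (a : R) (x : 'rV[R]_d) :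
  norm1 (a *: x) = `|a| * norm1 x.
Proof. by rewrite /norm1 mulr_sumr; apply: eq_bigr => i _; rewrite mxE normrM. Qed.

Lemma corners_dist_ge2 (R : realType) (d : nat) (x y : 'rV[R]_d) (i : 'I_d) :
  cube_corners R d x -> cube_corners R d y -> x 0 i = 1 -> y 0 i = 0 ->
  x <> y + delta_mx 0 i -> 2 <= norm1 (x - y).
Proof.
move=> cx cy xi yi xy.
have [j ji xyj] : exists2 j, j != i & x 0 j != y 0 j.
  apply/exists_inP; apply: contra_notT xy => /exists_inPn xy.
  apply/rowP => j; rewrite !mxE eqxx /=; have [->|ji] := eqVneq j i.
    by rewrite xi yi add0r.
  by rewrite addr0; apply/eqP; have := xy j ji; rewrite negbK.
rewrite /norm1 (bigD1 i)//= (bigD1 j)//= !mxE xi yi subr0 normr1.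
have -> : `|x 0 j - y 0 j| = 1.
  by move: xyj; case: (cx j) (cy j) => -> [] ->;
    rewrite ?eqxx// ?subr0 ?sub0r ?normrN normr1.
by rewrite addrA lerDl sumr_ge0.
Qed.

(** Affine independence makes the matrix with rows [(1, v k)] invertible; the weights solve the
    system with right side [(0, x)]. *)
Lemma affinely_independent_span (R : realType) (d : nat)
    (v : 'I_d.+1 -> 'rV[R]_d) (x : 'rV[R]_d) : affinely_independent v ->
  exists c : 'I_d.+1 -> R, \sum_k c k = 0 /\ \sum_k c k *: v k = x.
Proof.
move=> av; pose M : 'M[R]_(1 + d) := \matrix_(k < 1 + d) row_mx 1%:M (v k).
have ME (u : 'rV[R]_(1 + d)) :
    u *m M = row_mx (\sum_k u 0 k)%:M (\sum_k u 0 k *: v k).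
  rewrite mulmx_sum_row; under eq_bigr do rewrite rowK scale_row_mx.
  apply/rowP => j; rewrite summxE.
  case: (split_ordP j) => k ->; rewrite ?row_mxEl ?row_mxEr ?summxE.
    rewrite ord1 mxE eqxx; apply: eq_bigr => l _.
    by rewrite row_mxEl !mxE mulr1.
  by apply: eq_bigr => l _; rewrite row_mxEr.
have Mu : M \in unitmx.
  rewrite -row_free_unit; apply: inj_row_free => u; rewrite ME.
  move=> /rowP h; apply/rowP => k; rewrite mxE.
  apply: (av (fun k => u 0 k)).
    by have := h (lshift d (0 : 'I_1)); rewrite row_mxEl !mxE.
  by apply/rowP => j; have := h (rshift 1 j); rewrite row_mxEr !mxE.
pose u := row_mx 0 x *m invmx M.
exists (fun k => u 0 k).
have : u *m M = row_mx 0 x by rewrite /u -mulmxA mulVmx ?mulmx1.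
rewrite ME => /eq_row_mx[/matrixP/(_ 0 0) + ->]; by rewrite !mxE.
Qed.

(* Without an edge parallel to e_i, the vertices on the faces x_i = 0 and
   x_i = 1 are at distance at least 2, so 2 x_i is 1-Lipschitz on the vertices
   although its interpolant has slope 2. *)
Lemma simplex_edge (R : realType) (d : nat) (S : set (set 'rV[R]_d))
    (v : 'I_d.+1 -> 'rV[R]_d) (i : 'I_d) :
  lipschitz_interpolation S -> S (conv_hull v) ->
  (forall k, cube_corners R d (v k)) -> affinely_independent v ->
  exists pq : 'I_d.+1 * 'I_d.+1, v pq.2 = v pq.1 + delta_mx 0 i.
Proof.
move=> LS Sv kv av; apply: contrapT => nedge.
pose f := capped_dist 2 (fun k => v k 0 i == 0) v.
have fv k : f (v k) = 2 * v k 0 i.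
  case: (kv k i) => vki; rewrite vki.
    by rewrite mulr0 /f capped_dist_eq0 ?ler0n ?vki.
  rewrite mulr1; apply/le_anti/andP; split; first exact: bigmin_le_id.
  apply/bigmin_geP; split=> // l /eqP vli.
  apply: (corners_dist_ge2 (kv k) (kv l) vki vli) => vkl.
  by apply: nedge; exists (l, k).
(* [c] is the rate of change of the weights in direction [e_i]; the step [e] below is small enough
   that the barycenter moved by [e] keeps nonnegative weights. *)
have [c [c0 cv]] := affinely_independent_span (delta_mx 0 i) av.
pose n : R := d.+1%:R; have n0 : 0 < n by rewrite ltr0n.
pose B := 1 + \sum_k `|c k|.
have B0 : 0 < B by rewrite ltr_wpDr// sumr_ge0.
pose e := (n * B)^-1; have e0 : 0 < e by rewrite invr_gt0 mulr_gt0.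
have cB k : `|c k| <= B.
  rewrite /B (bigD1 k)//= addrCA lerDl addr_ge0// sumr_ge0//.
have w1 : \sum_(k < d.+1) n^-1 = 1.
  by rewrite sumr_const card_ord -[_ *+ _]mulr_natl divff ?lt0r_neq0.
have := LS f v v (fun k => n^-1 + e * c k) (fun=> n^-1)
  (capped_dist_lipschitz _ _ _) Sv Sv kv kv.
have wE (g : 'I_d.+1 -> R) :
    \sum_k (n^-1 + e * c k) * g k = \sum_k n^-1 * g k + e * \sum_k c k * g k.
  by rewrite mulr_sumr -big_split; apply: eq_bigr => k _ /=; ring.
have -> : \sum_k (n^-1 + e * c k) *: v k - \sum_k n^-1 *: v k
    = e *: delta_mx 0 i.
  rewrite -cv scaler_sumr -sumrB; apply: eq_bigr => k _.
  by rewrite scalerDl scalerA addrC addKr.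
rewrite norm1Z norm1_delta (ger0_norm (ltW e0)) mulr1 wE.
have -> : \sum_k c k * f (v k) = 2.
  under eq_bigr do rewrite fv mulrCA; rewrite -mulr_sumr.
  have /rowP/(_ i) := cv; rewrite summxE; under eq_bigr do rewrite mxE.
  by move=> ->; rewrite mxE !eqxx mulr1.
have p0 : forall k, 0 <= n^-1 + e * c k.
  move=> k; have h0 : e * `|c k| <= n^-1.
    rewrite /e invfM -mulrA ler_piMr ?invr_ge0 ?(ltW n0)//.
    by rewrite ler_pdivrMl// mulr1.
  have := ler_norm (- c k); rewrite normrN => h1.
  have h2 : e * - c k <= e * `|c k| by rewrite ler_wpM2l// ltW.
  by rewrite -lerBlDr sub0r -mulrN (le_trans h2 h0).
have q0 : 'I_d.+1 -> 0 <= n^-1 by rewrite invr_ge0 ltW.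
have p1 : \sum_k (n^-1 + e * c k) = 1.
  by rewrite big_split /= -mulr_sumr c0 mulr0 addr0.
move=> /(_ p0 q0 p1 w1).
(* What remains is [e * 2 <= e], against [0 < e]. *)
by rewrite lerD2l mulr_natr mulr2n gerDl leNgt e0.
Qed.

(** * The tree of edges and its leaves *)

(** Expanding the point minus [v k] in unit vectors and replacing the [i]-th by [v (q i) - v (p i)]
    writes the point as an affine combination of the vertices; such weights are unique. *)
Lemma barycentric_edges (R : realType) (d : nat) (v : 'I_d.+1 -> 'rV[R]_d)
    (p q : 'I_d -> 'I_d.+1) (c : 'I_d.+1 -> R) (k : 'I_d.+1) :
  affinely_independent v -> (forall i, v (q i) = v (p i) + delta_mx 0 i) ->
  \sum_l c l = 1 ->
  c k = 1 + \sum_i ((\sum_l c l *: v l) 0 i - v k 0 i)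
                  * ((q i == k)%:R - (p i == k)%:R).
Proof.
move=> av pq c1; set x := \sum_l c l *: v l.
pose a l := c l - (l == k)%:R
  - \sum_i (x 0 i - v k 0 i) * ((q i == l)%:R - (p i == l)%:R).
suff : a k = 0 by rewrite /a eqxx => /eqP; rewrite subr_eq0 subr_eq addrC => /eqP.
have pick1 (m : 'I_d.+1) : \sum_l (m == l)%:R = 1 :> R.
  by rewrite (bigD1 m)//= eqxx big1 ?addr0// => l; rewrite eq_sym => /negbTE->.
have pickv (m : 'I_d.+1) : \sum_l (m == l)%:R *: v l = v m.
  rewrite (bigD1 m)//= eqxx scale1r big1 ?addr0// => l.
  by rewrite eq_sym => /negbTE->; rewrite scale0r.
apply: av.
  rewrite !sumrB c1 exchange_big /= (eq_bigr (fun l => (k == l)%:R)); last first.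
    by move=> l _; rewrite eq_sym.
  rewrite pick1 big1 ?subrr ?subr0// => i _.
  by rewrite -mulr_sumr sumrB !pick1 subrr mulr0.
under eq_bigr do rewrite !scalerBl.
rewrite !sumrB -/x (eq_bigr (fun l => (k == l)%:R *: v l)); last first.
  by move=> l _; rewrite eq_sym.
rewrite pickv.
have -> : \sum_l (\sum_i (x 0 i - v k 0 i) * ((q i == l)%:R - (p i == l)%:R)) *: v l
    = \sum_i (x 0 i - v k 0 i) *: delta_mx 0 i.
  under eq_bigr do rewrite scaler_suml.
  rewrite exchange_big; apply: eq_bigr => i _ /=.
  under eq_bigr do rewrite -scalerA [X in _ *: X]scalerBl.
  by rewrite -scaler_sumr sumrB !pickv pq [v _ + _]addrC addrK.
rewrite [X in X - _]row_sum_delta -sumrB big1// => i _.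
by rewrite !mxE subrr.
Qed.

Section Leaves.
Variables (R : realType) (d : nat) (v : 'I_d.+1 -> 'rV[R]_d).
Variables (p q : 'I_d -> 'I_d.+1).
Hypothesis av : affinely_independent v.
Hypothesis kv : forall k, cube_corners R d (v k).
Hypothesis pq : forall i, v (q i) = v (p i) + delta_mx 0 i.

Definition edge_degree (k : 'I_d.+1) : nat := \sum_i ((q i == k) + (p i == k)).

(** By [barycentric_edges], the weight of an isolated vertex would be 1 at every point, yet it is 0
    at another vertex [l]. *)
Lemma edge_degree_gt0 k : (0 < d)%N -> (0 < edge_degree k)%N.
Proof.
move=> d0; rewrite lt0n; apply/eqP => /eqP; rewrite sum_nat_eq0 => /forallP deg0.
pose l : 'I_d.+1 := if k == ord0 then ord_max else ord0.
have lk : l != k.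
  rewrite /l; case: (eqVneq k ord0) => [->|]; last by rewrite eq_sym.
  by rewrite -val_eqE /= -lt0n.
have l1 : \sum_m (m == l)%:R = 1 :> R.
  by rewrite (bigD1 l)//= eqxx big1 ?addr0// => m /negbTE->.
have := barycentric_edges k av pq l1.
rewrite eq_sym (negbTE lk) big1 ?addr0 => [/eqP|i _].
  by rewrite eq_sym oner_eq0.
have := deg0 i; rewrite /= addn_eq0 !eqb0 => /andP[/negbTE-> /negbTE->].
by rewrite subrr mulr0.
Qed.

Lemma sum_edge_degree : (\sum_k edge_degree k = d.*2)%N.
Proof.
rewrite exchange_big /= (eq_bigr (fun=> 2%N)); last first.
  move=> i _; rewrite big_split /=.
  have pick1 (m : 'I_d.+1) : (\sum_l (m == l) = 1)%N.
    by rewrite (bigD1 m)//= eqxx big1 ?addn0// => l; rewrite eq_sym => /negbTE->.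
  by rewrite !pick1.
by rewrite sum_nat_const card_ord muln2.
Qed.

(** The [d + 1] degrees are positive and add up to [2 d]; adding 1 at each leaf makes every term at
    least 2, so there are at least two leaves. *)
Lemma two_leaves : (0 < d)%N ->
  exists k l, [/\ edge_degree k = 1%N, edge_degree l = 1%N & k != l].
Proof.
move=> d0; pose A := [pred k | edge_degree k == 1%N].
suff /card_gt1P[k [l [/eqP kA /eqP lA kl]]] : (1 < #|A|)%N by exists k, l.
have EA : (\sum_k (edge_degree k == 1%N) = #|A|)%N.
  by rewrite -sum1_card [RHS]big_mkcond; apply: eq_bigr => k _; rewrite inE; case: eqP.
rewrite -(leq_add2l d.*2) addn2 -doubleS -EA -sum_edge_degree -big_split /=.
rewrite -[d.+1 in leqLHS]card_ord -muln2 -sum_nat_const.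
apply: leq_sum => k _; have := edge_degree_gt0 k d0.
by case: (edge_degree k) => [|[|]].
Qed.

(** In [barycentric_edges] only the single edge at [k] contributes; whichever end of it [k] is, the
    contribution at the center is [-1/2]. *)
Lemma leaf_weight k (c : 'I_d.+1 -> R) : edge_degree k = 1%N ->
  \sum_l c l = 1 -> (forall i, (\sum_l c l *: v l) 0 i = 2^-1) -> c k = 2^-1.
Proof.
move=> /eqP/sum_nat_eq1[i [_ degi deg0]] c1 cx.
rewrite (barycentric_edges k av pq c1) (bigD1 i)//= cx big1 ?addr0 => [|j ji].
  have /rowP/(_ i) := pq i; rewrite !mxE !eqxx.
  move: degi; case: eqP => [->|_]; case: eqP => [pk|_] //= _ vk.
    by case: (kv k i) (kv (p i) i) vk => -> [] ->; lra.
  by rewrite -pk; case: (kv (q i) i) (kv (p i) i) vk => -> [] ->; lra.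
move/eqP: (deg0 j ji isT); rewrite addn_eq0 !eqb0 => /andP[/negbTE-> /negbTE->].
by rewrite subrr mulr0.
Qed.
End Leaves.

(** * The diagonal and the order of the coordinates *)

Lemma diagonal_simplex (R : realType) (d : nat) (S : set (set 'rV[R]_d)) :
  (0 < d)%N -> triangulation (cube R d) S -> lipschitz_interpolation S ->
  exists (v : 'I_d.+1 -> 'rV[R]_d) (k l : 'I_d.+1),
    [/\ S (conv_hull v), forall m, cube_corners R d (v m), k != l &
      forall i, v l 0 i = 1 - v k 0 i].
Proof.
move=> d0 trS LS; have [_ _ cS _ _] := trS.
have [s Ss] : (\bigcup_(s in S) s) (const_mx 2^-1).
  by rewrite cS => i; rewrite mxE; lra.
have [v [av sE kv]] := triangulation_simplex trS Ss.
rewrite sE => -[c [c0 c1 cx]]; rewrite sE in Ss.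
have /choice[pq pqE] i := simplex_edge i LS Ss kv av.
pose p i := (pq i).1; pose q i := (pq i).2.
have [k [l [dk dl kl]]] := two_leaves av pqE d0.
have cx' i : (\sum_m c m *: v m) 0 i = 2^-1 by rewrite -cx mxE.
have ck := leaf_weight av kv pqE dk c1 cx'.
have cl := leaf_weight av kv pqE dl c1 cx'.
exists v, k, l; split=> // i.
have lk : l != k by rewrite eq_sym.
(* The two leaves already carry the total weight 1. *)
have cm m : m != k -> m != l -> c m = 0.
  move=> mk ml; apply/le_anti/andP; split=> //.
  have := c1; rewrite (bigD1 k)//= (bigD1 l)//= (bigD1 m) /=; last by rewrite mk ml.
  have : 0 <= \sum_(j | (j != k) && (j != l) && (j != m)) c j by apply: sumr_ge0.
  lra.
have := cx' i; rewrite summxE (bigD1 k)//= (bigD1 l)//= big1 => [|m /andP[mk ml]].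
  by rewrite !mxE ck cl; lra.
by rewrite cm// scale0r mxE.
Qed.

(* The function [f] is the largest 1-Lipschitz function agreeing at the ends of
   the diagonal with the affine function [g] of slopes [eps], for which the
   Lipschitz bound between x and the point at height t is attained. *)
Lemma diagonal_chain (R : realType) (d : nat) (S : set (set 'rV[R]_d))
    (v0 v : 'I_d.+1 -> 'rV[R]_d) (k0 l0 k : 'I_d.+1) (b : pred 'I_d)
    (c : 'I_d.+1 -> R) (i j : 'I_d) :
  lipschitz_interpolation S ->
  S (conv_hull v0) -> (forall m, cube_corners R d (v0 m)) -> k0 != l0 ->
  flip b (v0 k0) = 0 -> flip b (v0 l0) = const_mx 1 ->
  S (conv_hull v) -> (forall m, cube_corners R d (v m)) ->
  (forall m, 0 <= c m) -> \sum_m c m = 1 ->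
  (\sum_m c m *: flip b (v m)) 0 j < (\sum_m c m *: flip b (v m)) 0 i ->
  c k != 0 -> flip b (v k) 0 j <= flip b (v k) 0 i.
Proof.
move=> LS Sv0 kv0 kl0 u0 u1 Sv kv c0 c1 xji ck.
pose z m := flip b (v m).
have kz m : cube_corners R d (z m) by exact: flip_corner.
have cz m : cube R d (z m) by exact: corner_cube.
rewrite -/(z k); move: xji; set x := \sum_m c m *: z m => xji.
have cx : cube R d x by exact: comb_cube.
case: (kz k j) => [->|zj]; first by case/andP: (cz k i).
case: (kz k i) => [zi|->]; last by rewrite zj.
exfalso.
pose t := (x 0 j + x 0 i) / 2.
have [jt ti] : x 0 j < t /\ t < x 0 i by split; rewrite /t; lra.
have t01 : 0 <= t <= 1.
  by have /andP[? ?] := cx i; have /andP[? ?] := cx j; rewrite /t; lra.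
(* The signs of the coordinates of [x] minus [t]; the choice of [t] gives [eps i = 1] and
   [eps j = -1]. *)
pose eps m : R := if t <= x 0 m then 1 else -1.
have eps1 m : -1 <= eps m <= 1 by rewrite /eps; case: ifP => _; lra.
pose K := \sum_m eps m.
pose g (y : 'rV[R]_d) := \sum_m eps m * y 0 m.
pose o : 'rV[R]_d := const_mx 1.
have subo (y : 'rV[R]_d) m : (y - o) 0 m = y 0 m - 1 by rewrite !mxE.
pose f y := Num.min (norm1 y) (norm1 (y - o) + K).
have lf : lipschitz1 (fun y => f (flip b y)).
  move=> y1 y2; rewrite -(norm1_flip b) /f.
  move: (flip b y1) (flip b y2) => y y'.
  have n1 : norm1 y <= norm1 y' + norm1 (y - y').
    by have := norm1B_triangle y y' 0; rewrite !subr0 [X in _ <= X -> _]addrC.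
  have n2 : norm1 (y - o) <= norm1 (y' - o) + norm1 (y - y').
    by rewrite [leRHS]addrC norm1B_triangle.
  rewrite addr_minl le_min !ge_min; apply/andP; split; apply/orP.
    by left.
  by right; rewrite addrAC lerD2r.
have g_le0 y : cube R d y -> g y <= norm1 y.
  move=> cy; apply: ler_sum => m _; have /andP[y0 y1] := cy m.
  by rewrite ger0_norm// ler_piMl//; case/andP: (eps1 m).
have go y : g y = K + \sum_m eps m * (y - o) 0 m.
  rewrite -big_split; apply: eq_bigr => m _; rewrite !mxE /=; ring.
have g_le1 y : cube R d y -> g y <= norm1 (y - o) + K.
  move=> cy; rewrite go [leLHS]addrC lerD2r; apply: ler_sum => m _.
  rewrite !mxE; have /andP[y0 y1] := cy m; have /andP[e0 e1] := eps1 m.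
  by rewrite ler0_norm ?subr_le0//; nra.
have f0 : f 0 <= 0.
  by rewrite /f ge_min {1}/norm1 big1 ?lexx// => m _; rewrite mxE normr0.
have f1 : f o <= K.
  rewrite /f ge_min subrr {2}/norm1 [X in X + K]big1 ?add0r ?lexx ?orbT// => m _.
  by rewrite mxE normr0.
(* The weights of the diagonal point at height [t] in the simplex of [v0]. *)
pose a m : R := if m == k0 then 1 - t else if m == l0 then t else 0.
have aE (V : lmodType R) (h : 'I_d.+1 -> V) :
    \sum_m a m *: h m = (1 - t) *: h k0 + t *: h l0.
  rewrite (bigD1 k0)//= (bigD1 l0) /=; last by rewrite eq_sym.
  rewrite big1 ?addr0 /a => [|m /andP[/negbTE-> /negbTE->]]; last exact: scale0r.
  by rewrite !eqxx eq_sym (negbTE kl0).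
have a0 m : 0 <= a m by rewrite /a; case: ifP => _; [lra|case: ifP => _; lra].
have a1 : \sum_m a m = 1.
  have := aE R^o (fun=> 1); under eq_bigr do rewrite scaler1.
  by move=> ->; rewrite -scalerDl subrK scale1r.
have := LS _ v v0 c a lf Sv Sv0 kv kv0 c0 a0 c1 a1.
have -> : \sum_m a m * f (flip b (v0 m)) = (1 - t) * f 0 + t * f o.
  by rewrite (aE R^o) u0 u1.
rewrite -(norm1_flip b) !flip_comb// -/x aE u0 u1 scaler0 add0r.
have -> : norm1 (x - t *: const_mx 1) = g x - t * K.
  rewrite mulr_sumr -sumrB; apply: eq_bigr => m _; rewrite !mxE /eps mulr1.
  by case: leP => tx; [rewrite ger0_norm|rewrite ltr0_norm]; lra.
have gx : g x = \sum_m c m * g (z m).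
  under [RHS]eq_bigr do rewrite mulr_sumr.
  rewrite exchange_big; apply: eq_bigr => m _.
  rewrite summxE mulr_sumr; apply: eq_bigr => l _.
  by rewrite !mxE; ring.
(* [z k] has coordinate 0 at [i] and 1 at [j], against the signs [eps]: coordinate [j] gains 2 over
   [g] in the first term of [f], coordinate [i] in the second. *)
have fk : g (z k) + 2 <= f (z k).
  have ei : eps i = 1 by rewrite /eps ltW.
  have ej : eps j = -1 by rewrite /eps leNgt jt.
  rewrite /f le_min; apply/andP; split.
    rewrite [leLHS]addrC -lerBrDr -sumrB (bigD1 j)//= ej zj normr1.
    have : 0 <= \sum_(m | m != j) (`|z k 0 m| - eps m * z k 0 m).
      apply: sumr_ge0 => m _; have /andP[y0 y1] := cz k m.
      by rewrite subr_ge0 ger0_norm// ler_piMl//; case/andP: (eps1 m).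
    lra.
  rewrite go -addrA [leLHS]addrC lerD2r [leLHS]addrC -lerBrDr -sumrB (bigD1 i)//=.
  rewrite subo ei zi sub0r normrN normr1.
  have : 0 <= \sum_(m | m != i) (`|(z k - o) 0 m| - eps m * (z k - o) 0 m).
    apply: sumr_ge0 => m _; have /andP[y0 y1] := cz k m.
    have /andP[e0 e1] := eps1 m.
    by rewrite subo ler0_norm ?subr_le0//; nra.
  lra.
(* The interpolated value at [x] is thus at least [g x + 2 * c k], while the bound from the diagonal
   allows at most [g x]. *)
have : \sum_m c m * g (z m) + 2 * c k <= \sum_m c m * f (z m).
  rewrite (bigD1 k)//= [leRHS](bigD1 k)//= addrAC lerD//.
    by rewrite [2 * _]mulrC -mulrDr ler_wpM2l.
  apply: ler_sum => m _; rewrite ler_wpM2l// /f le_min.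
  by rewrite g_le0// g_le1.
have ck0 : 0 < c k by rewrite lt_def ck c0.
have h1 : (1 - t) * f 0 <= 0 by rewrite mulr_ge0_le0//; lra.
have h2 : t * f o <= t * K by rewrite ler_wpM2l//; lra.
rewrite gx; lra.
Qed.

(** * Identification of the simplices *)

(** The map [g] choosing an index in [v] for each index in [w] is injective, hence a permutation,
    along which weights are transported. *)
Lemma conv_hull_reindex (R : realType) (d n : nat) (v w : 'I_n -> 'rV[R]_d) :
  injective w -> (forall k, exists l, v l = w k) -> conv_hull w = conv_hull v.
Proof.
move=> wi /choice[g gE].
have gi : injective g by move=> k l kl; apply: wi; rewrite -!gE kl.
apply/seteqP; split=> _ [c [c0 c1 ->]].
  exists (c \o invF gi); split=> [k||]; first exact: c0.
    by rewrite -c1 [RHS](reindex_inj (can_inj (f_invF gi))).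
  rewrite [LHS](reindex_inj (can_inj (f_invF gi))).
  by apply: eq_bigr => k _; rewrite -gE /= f_invF.
exists (c \o g); split=> [k||]; first exact: c0.
  by rewrite -c1 [RHS](reindex_inj gi).
by rewrite [LHS](reindex_inj gi); apply: eq_bigr => k _; rewrite gE.
Qed.

Lemma affinely_independent_inj (R : realType) (d n : nat)
    (v : 'I_n -> 'rV[R]_d) : affinely_independent v -> injective v.
Proof.
move=> av k l kl; apply/eqP/negPn/negP => nkl.
have pick1 (V : lmodType R) (h : 'I_n -> V) m : \sum_i (i == m)%:R *: h i = h m.
  rewrite (bigD1 m)//= eqxx scale1r big1 ?addr0// => i /negbTE->.
  by rewrite scale0r.
have := av (fun i => (i == k)%:R - (i == l)%:R) _ _ k.
rewrite eqxx (negbTE nkl) subr0 => h.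
have /eqP : 1 = 0 :> R; last by rewrite oner_eq0.
apply: h.
  have pick m : \sum_(i < n) (i == m)%:R = 1 :> R.
    by rewrite (bigD1 m)//= eqxx big1 ?addr0// => i /negbTE->.
  by rewrite sumrB !pick subrr.
by under eq_bigr do rewrite scalerBl; rewrite sumrB !pick1 kl subrr.
Qed.

(** The weight of a vertex is the probability that the level corner of [x] is that vertex. *)
Lemma sorted_conv_kuhn (R : realType) (d : nat) (x : 'rV[R]_d) (tau : 'S_d) :
  cube R d x -> sorted_by x tau -> conv_hull (kuhn_point R tau) x.
Proof.
move=> cx sx; have [n [p [t [p0 p1 px _]]]] := thresholds_pair cx cx.
have /choice[K KE] m :=
  sorted_corner (@level_corner _ _ (t m) x) (level_sorted (t m) sx).
exists (fun k => \sum_(m | K m == k) p m); split=> [k||].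
- exact: sumr_ge0.
- by rewrite -[RHS]p1 (partition_big K xpredT).
- rewrite -[LHS](thresholds_comb px) (partition_big K xpredT)//=.
  apply: eq_bigr => k _; rewrite scaler_suml.
  by apply: eq_bigr => m /eqP<-; rewrite KE.
Qed.

Lemma lipschitz_flipped_kuhn (R : realType) (d : nat) (S : set (set 'rV[R]_d)) :
  (0 < d)%N -> triangulation (cube R d) S -> lipschitz_interpolation S ->
  exists b : pred 'I_d, S = flipped_kuhn R b.
Proof.
move=> d0 trS LS; have [_ _ cS _ _] := trS.
have [v0 [k0 [l0 [Sv0 kv0 kl0 vl0]]]] := diagonal_simplex d0 trS LS.
pose b : pred 'I_d := fun i => v0 k0 0 i == 1.
have u0 : flip b (v0 k0) = 0.
  apply/rowP => i; rewrite !mxE /b; case: eqP => [->|]; first by rewrite subrr.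
  by case: (kv0 k0 i).
have u1 : flip b (v0 l0) = const_mx 1.
  apply/rowP => i; rewrite !mxE /b vl0 subKr; case: eqP => // h.
  by case: (kv0 k0 i) => // ->; rewrite subr0.
pose e : R := d.+1%:R^-1.
have e0 : 0 < e by rewrite invr_gt0 ltr0n.
have e1 : \sum_(k < d.+1) e = 1.
  by rewrite sumr_const card_ord -[_ *+ _]mulr_natl divff ?pnatr_eq0.
have simplex_in x : cube R d x -> exists (v : 'I_d.+1 -> 'rV[R]_d) c,
    [/\ S (conv_hull v), forall k, cube_corners R d (v k),
        forall k, 0 <= c k, \sum_k c k = 1 & x = \sum_k c k *: v k].
  rewrite -cS => -[s Ss sx]; have [v [av sE kv]] := triangulation_simplex trS Ss.
  by move: sx Ss; rewrite sE => -[c [c0 c1 xE]] Ss; exists v, c.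
have kuhn_in (tau : 'S_d) : S (conv_hull (fun k => flip b (kuhn_point R tau k))).
  (* The coordinates of this barycenter decrease strictly along [tau], so by [diagonal_chain] the
     vertices carrying weight at [flip b y] in a simplex of [S] are reflected Kuhn points of
     [tau]. *)
  pose y := \sum_k e *: kuhn_point R tau k.
  have yE i : y 0 (tau i) = \sum_(k < d.+1) e * (i < k)%:R.
    by rewrite summxE; apply: eq_bigr => k _; rewrite mxE kuhn_pointE.
  have ylt (i j : 'I_d) : (i < j)%N -> y 0 (tau j) < y 0 (tau i).
    move=> ij; rewrite !yE; pose k := widen_ord (leqnSn d) j.
    rewrite (bigD1 k)//= [ltRHS](bigD1 k)//= ltnn ij mulr0 mulr1 ltr_leD//.
    apply: ler_sum => m _; rewrite ler_wpM2l ?(ltW e0)// ler_nat.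
    by case: (ltnP j m) => // jm; rewrite (ltn_trans ij jm).
  have cy : cube R d y.
    apply: comb_cube => // [k|k]; first exact: ltW.
    exact/corner_cube/kuhn_point_corner.
  have [v [c [Sv kv c0 c1 yv]]] := simplex_in _ (flip_cube b cy).
  have yz : y = \sum_k c k *: flip b (v k) by rewrite -flip_comb// -yv flipK.
  have zs k : c k != 0 -> sorted_by (flip b (v k)) tau.
    move=> ck i j; rewrite leq_eqVlt => /predU1P[/val_inj->//|ij].
    apply: (diagonal_chain LS Sv0 kv0 kl0 u0 u1 Sv kv c0 c1 _ ck).
    by rewrite -yz ylt.
  rewrite (@conv_hull_reindex _ _ _ v)//.
    by move=> k l /(can_inj (@flipK _ _ b))/kuhn_point_inj.
  (* With this [h], [kuhn_affine h tau] is the [m]-th barycentric coordinate; its value [e] at [y]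
     would be 0 if the [m]-th Kuhn point carried no weight. *)
  move=> m; pose h (z : 'rV[R]_d) : R := (z == kuhn_point R tau m)%:R.
  have hy : kuhn_affine h tau y = e.
    rewrite kuhn_affine_comb// (bigD1 m)//= kuhn_affine_point /h eqxx mulr1.
    rewrite big1 ?addr0// => k /negbTE km.
    by rewrite kuhn_affine_point (inj_eq (@kuhn_point_inj _ _ _)) km mulr0.
  have [k ck vk] : exists2 k, c k != 0 & flip b (v k) = kuhn_point R tau m.
    apply: contrapT => nk; move: e0; rewrite -hy yz kuhn_affine_comb//.
    rewrite big1 ?ltxx// => k _; have [->|ck] := eqVneq (c k) 0.
      by rewrite mul0r.
    have [l zl] := sorted_corner (flip_corner b (kv k)) (zs k ck).
    rewrite zl kuhn_affine_point /h; case: eqP => [lm|]; last by rewrite mulr0.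
    by case: nk; exists k; rewrite // zl.
  by exists k; rewrite -vk flipK.
exists b; apply/seteqP; split=> [s Ss|_ [tau _ <-]]; last exact: kuhn_in.
have [v [av sE kv]] := triangulation_simplex trS Ss.
(* This barycenter also lies in a reflected Kuhn simplex, which belongs to [S] by [kuhn_in]. *)
pose x := \sum_k e *: v k.
have cx : cube R d x.
  apply: comb_cube => // [k|k]; [exact: ltW|exact: corner_cube].
have [tau sx] := sorted_by_exists (flip b x).
have [c [c0 c1 xE]] := sorted_conv_kuhn (flip_cube b cx) sx.
exists tau => //; rewrite sE; apply/esym/conv_hull_reindex.
  exact: affinely_independent_inj.
move=> k; apply: contrapT => nk.
pose w l := flip b (kuhn_point R tau l).
(* [f] vanishes at the vertices of the Kuhn simplex, so its interpolated value at [x] is 0 there; a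
   vertex [v k] not among them would make the mean of [f] over [v] positive. *)
pose f := capped_dist 1 xpredT w.
have kw l : cube_corners R d (w l) by exact/flip_corner/kuhn_point_corner.
rewrite sE in Ss.
have := LS f v w (fun=> e) c (capped_dist_lipschitz _ _ _) Ss (kuhn_in tau)
  kv kw (fun=> ltW e0) c0 e1 c1.
have -> : \sum_l c l *: w l = x by rewrite -flip_comb// -xE flipK.
have -> : \sum_l c l * f (w l) = 0.
  by rewrite big1// => l _; rewrite /f capped_dist_eq0// mulr0.
rewrite subrr add0r [norm1 0]big1 => [|i _]; last by rewrite mxE normr0.
rewrite (bigD1 k)//=.
have fk : 0 < f (v k).
  apply/bigmin_gtP; split=> // l _; rewrite lt_def norm1_ge0 andbT.
  apply/eqP => h; apply: nk; exists l; apply/esym/eqP.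
  by rewrite -subr_eq0; apply/eqP/norm1_eq0.
have : 0 <= \sum_(i | i != k) e * f (v i).
  apply: sumr_ge0 => i _; rewrite mulr_ge0 ?(ltW e0)//.
  by apply/bigmin_geP; split=> // l _; exact: norm1_ge0.
have : 0 < e * f (v k) by rewrite mulr_gt0.
lra.
Qed.

Theorem theorem6p1 (R : realType) (d : nat) (d_gt0 : (0 < d)%N)
    (S : set (set 'rV[R]_d)) (trS : triangulation (cube R d) S) :
  optimal_interpolation S <->
  exists r : seq 'I_d, S = [set reflections r @` s | s in kuhn R d].
Proof.
split=> [oS|[r ->]]; last by rewrite reflected_kuhnE; exact: optimal_flipped_kuhn.
have [_ _ cS _ _] := trS.
have [b ->] := lipschitz_flipped_kuhn d_gt0 trS (optimal_lipschitz cS oS).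
(* Each selected coordinate is listed once, so the parities of the counts give back [b]. *)
exists [seq i <- enum 'I_d | b i]; rewrite reflected_kuhnE; congr flipped_kuhn.
apply/funext => i; rewrite count_uniq_mem; last exact/filter_uniq/enum_uniq.
by rewrite mem_filter mem_enum andbT oddb.
Qed.
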